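(* The wriggle polynomial $K\mapsto W_K(t)$ of virtual knots is a Vassiliev invariant of virtual knots of order one (that is, of order $\le 1$ but not of order $\le 0$).
   Context: **Virtual knots.** A virtual knot diagram is a generic immersion of an oriented circle into the plane in which every double point is marked as a classical crossing (positive or negative) or a virtual crossing. A virtual knot is an equivalence class of diagrams up to planar isotopy, the classical Reidemeister moves R1, R2, R3, and the virtual Reidemeister moves (the analogues of R1, R2, R3 with all crossings virtual, and the mixed move in which a strand with two consecutive virtual crossings is moved across a classical crossing). Each classical crossing $c$ has a sign $sgn(c)=\pm1$ in the usual way. **Wriggle number.** For an ordered pair $(L_1,L_2)$ of components of an oriented virtual link diagram, $vlk(L_1,L_2)=\sum_{d} sgn(d)$, summed over classical crossings $d$ where $L_1$ goes over $L_2$. The wriggle number is $W(L_1,L_2)=vlk(L_1,L_2)-vlk(L_2,L_1)$. **Wriggle polynomial.** The oriented smoothing at a classical crossing $c$ joins the incoming understrand to the outgoing overstrand and the incoming overstrand to the outgoing understrand. Smoothing $K$ at $c$ gives a two-component oriented virtual link $L_c$; component one is the component containing the incoming understrand at $c$ and component two is the other. $W(L_c)$ denotes the wriggle number of (component one, component two). The wriggle polynomial is $$W_K(t)=\sum_{c} sgn(c)\,\bigl(t^{W(L_c)}-1\bigr),$$ summed over all classical crossings $c$ of $K$. It is known to be an invariant of virtual knots. **Vassiliev invariants.** A singular virtual knot is a virtual knot that may also have finitely many transverse double points as an additional type of crossing (considered up to planar isotopy, the classical Reidemeister moves R1, R2, R3, the virtual Reidemeister moves (the analogues of R1, R2, R3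 with all crossings virtual, and the mixed move in which a strand with two consecutive virtual crossings is moved across a classical crossing), and rigid vertex isotopy). An invariant $\nu$ of virtual knots is extended to singular virtual knots by the rule $\nu(\text{double point})=\nu(\text{positive crossing})-\nu(\text{negative crossing})$ applied at each double point. $\nu$ is a Vassiliev invariant of order $\le n$ if the extension vanishes on every singular virtual knot with more than $n$ double points; it is of order $n$ if it is of order $\le n$ but not of order $\le n-1$. *)

(* Defs.v *)
From Stdlib Require Import Relation_Operators.
From mathcomp Require Import all_boot all_order all_algebra.

Set Implicit Arguments.
Unset Strict Implicit.
Unset Printing Implicit Defensive.

Import Order.TTheory GRing.Theory Num.Theory.
Local Open Scope ring_scope.

(* Generic oriented closed plane curves, up to planar isotopy.                *)
(*   The double points are labelled by natural numbers.  Following the curve  *)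
(* once from a base point, the passages through the double points form a list *)
(* (the code of the curve).  The passage (x, true) is the one at which the    *)
(* other branch at x crosses from right to left, (x, false) the one at which  *)
(* it crosses from left to right.  Equivalently, in counterclockwise order    *)
(* the four half-edges at x are: (x, true) incoming, (x, false) incoming,     *)
(* (x, true) outgoing, (x, false) outgoing.                                   *)

Definition passage : Type := nat * bool.

Definition opp (p : passage) : passage := (p.1, ~~ p.2).

Definition crossings (c : seq passage) : seq nat := [seq p.1 | p <- c & p.2].

(* The dart (p, true) is the edge that leaves the passage p, directed forward *)
(* along the curve; (p, false) is the edge that enters p, directed backward.  *)
Definition dart : Type := passage * bool.

Definition darts (c : seq passage) : seq dart :=
  [seq (p, d) | p <- c, d <- [:: true; false]].

(* Next dart along the boundary of the face on the left of a dart: follow the *)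
(* dart to its end and take the leftmost turn there.                          *)
Definition turn (c : seq passage) (e : dart) : dart :=
  let: (p, d) := e in
  let l := if d then next c p else prev c p in
  (opp l, d == l.2).

Definition face (c : seq passage) (e : dart) : seq dart :=
  [seq e' <- darts c | e' \in traject (turn c) e (size (darts c))].

Definition faces (c : seq passage) : seq (seq dart) :=
  undup [seq face c e | e <- darts c].

(* Every double point is passed exactly twice, and the 4-valent map described *)
(* by the code has Euler characteristic 2: with n double points there are 2n  *)
(* edges, hence n + 2 faces.  The circle without double points is [::].       *)
Definition plane_code (c : seq passage) : bool :=
  [&& uniq c, all (fun p => opp p \in c) c
    & (c == [::]) || (size (faces c) == (size c)./2 + 2)%N].

(* Classical true is a positive crossing, Classical false a negative one;     *)
(* DoublePoint is a transverse double point of a singular knot.               *)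
Inductive marking := Classical of bool | Virtual | DoublePoint.

Definition is_classical (m : marking) : bool :=
  if m is Classical _ then true else false.

Definition is_double (m : marking) : bool :=
  if m is DoublePoint then true else false.

(* Diagrams of singular virtual knots in the plane.  The base point of the    *)
(* code lies on an edge adjacent to the unbounded face; outer_left tells      *)
(* whether that face is on the left or on the right of the curve there.  Only *)
(* the values of mark on the labels of the code are meaningful.               *)
Record diagram := Diagram {
  code : seq passage;
  outer_left : bool;
  mark : nat -> marking;
  codeP : plane_code code
}.

Definition double_points (D : diagram) : seq nat :=
  [seq x <- crossings (code D) | is_double (mark D x)].

(* Diagrams of virtual knots. *)
Definition nonsingular (D : diagram) : Prop := double_points D = [::].

(* A dart whose left face is the unbounded one (when code D <> [::]). *)
Definition outer_dart (D : diagram) : dart :=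
  let p0 := head (0%N, true) (code D) in
  if outer_left D then (prev (code D) p0, true) else (p0, false).

(* The two strands of a bigon with corners x and y.  The first strand runs    *)
(* from x to y, and so does the second one iff par holds.                     *)
Definition strand1 (x y : nat) (b : bool) : seq passage :=
  [:: (x, b); (y, ~~ b)].

Definition strand2 (par : bool) (x y : nat) (b : bool) : seq passage :=
  if par then [:: (x, ~~ b); (y, b)] else [:: (y, b); (x, ~~ b)].

(* A, B and C are the three strands of a triangle with corners x (between A   *)
(* and B), y (between B and C) and z (between C and A).  Its boundary, with   *)
(* the triangle on the left, runs along A, B and C in this cyclic order, and  *)
(* d1, d2, d3 tell whether A, B, C are then followed forward.                 *)
Definition triangle (d1 d2 d3 : bool) (x y z : nat) (A B C : seq passage) :=
  let strand (d : bool) (p q : passage) := if d then [:: p; q] else [:: q; p] in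
  [/\ A = strand d1 (z, d3 != d1) (x, d1 == d2),
      B = strand d2 (x, d1 != d2) (y, d2 == d3)
    & C = strand d3 (y, d2 != d3) (z, d3 == d1)].

(* At a positive crossing x the understrand crosses the overstrand from right *)
(* to left, so the overpass is (x, true); at a negative one it is (x, false). *)
Definition over (m : nat -> marking) (p : passage) : bool :=
  if m p.1 is Classical s then s == p.2 else false.

(* Markings of a triangle for which a strand can be moved across the opposite *)
(* corner, in the notation of triangle above.                                 *)
Definition slidable (d1 d2 d3 : bool) (x y z : nat) (m : nat -> marking) :
    bool :=
  let oAB := over m (x, d1 == d2) in
  let oBC := over m (y, d2 == d3) in
  let oCA := over m (z, d3 == d1) in
  match m x, m y, m z with
  (* R3: one strand is over the two others and one is under the two others *)
  | Classical _, Classical _, Classical _ => ~~ ((oAB == oBC) && (oBC == oCA))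
  (* two consecutive virtual crossings: virtual R3, and the mixed move across *)
  (* a classical crossing or a double point                                   *)
  | Virtual, Virtual, _ | Virtual, _, Virtual | _, Virtual, Virtual => true
  (* a strand passing over, or under, a double point *)
  | DoublePoint, Classical _, Classical _ => oBC != oCA
  | Classical _, DoublePoint, Classical _ => oCA != oAB
  | Classical _, Classical _, DoublePoint => oAB != oBC
  | _, _, _ => false
  end.

(* All moves take place away from the base point, hence leave the unbounded   *)
(* face unchanged.  As both sides are plane diagrams, a bigon can only be     *)
(* inserted between two strands that lie on a common face.  No move changes   *)
(* the number of double points: between nonsingular diagrams only planar      *)
(* isotopy and the classical and virtual Reidemeister moves are available.    *)
Inductive move (D D' : diagram) : Prop :=
| Relabel (f : nat -> nat) of
      outer_left D' = outer_left D
    & code D' = [seq (f p.1, p.2) | p <- code D]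
    & {in crossings (code D), forall x, mark D' (f x) = mark D x}
(* change of base point along the boundary of the unbounded face *)
| Rebase (k i : nat) of
      code D <> [::]
    & code D' = rot k (code D)
    & iter i (turn (code D)) (outer_dart D) = outer_dart D'
    & {in crossings (code D), mark D' =1 mark D}
| Reidemeister1 u v x b of
      outer_left D' = outer_left D
    & code D = u ++ v
    & code D' = u ++ [:: (x, b); (x, ~~ b)] ++ v
    & mark D' x <> DoublePoint
    & {in crossings (code D), mark D' =1 mark D}
| Reidemeister2 par u v w x y b of
      outer_left D' = outer_left D
    & code D = u ++ v ++ w
    & code D' = u ++ strand1 x y b ++ v ++ strand2 par x y b ++ w
    & (exists s, mark D' x = Classical s /\ mark D' y = Classical (~~ s))
      \/ (mark D' x = Virtual /\ mark D' y = Virtual)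
    & {in crossings (code D), mark D' =1 mark D}
| Reidemeister3 d1 d2 d3 x y z A B C u1 u2 u3 u4 of
      outer_left D' = outer_left D
    & triangle d1 d2 d3 x y z A B C \/ triangle d1 d2 d3 x y z A C B
    & slidable d1 d2 d3 x y z (mark D)
    & code D = u1 ++ A ++ u2 ++ B ++ u3 ++ C ++ u4
    & code D' = u1 ++ rev A ++ u2 ++ rev B ++ u3 ++ rev C ++ u4
    & {in crossings (code D), mark D' =1 mark D}
(* half-turn of a rigid vertex x, carrying the adjacent classical crossing y  *)
(* to the other side of x                                                     *)
| RigidVertexTwist par u v w x y b of
      outer_left D' = outer_left D
    & mark D x = DoublePoint
    & is_classical (mark D y)
    & code D = u ++ strand1 x y b ++ v ++ strand2 par x y b ++ w
    & code D' = u ++ strand1 y x b ++ v ++ strand2 par y x b ++ w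
    & {in crossings (code D), mark D' =1 mark D}.

(* Singular virtual knots are the classes of this relation, virtual knots     *)
(* those of its restriction to nonsingular diagrams.                          *)
Definition same_knot : diagram -> diagram -> Prop :=
  clos_refl_sym_trans diagram move.

(* The wriggle polynomial. *)

Definition sgn (m : marking) : int :=
  if m is Classical s then (if s then 1 else -1) else 0.

(* The components of a link are given by their lists of passages. *)
Definition vlk (m : nat -> marking) (L1 L2 : seq passage) : int :=
  \sum_(p <- L1 | over m p && (opp p \in L2)) sgn (m p.1).

Definition wriggle_number (m : nat -> marking) (L : seq passage * seq passage) :
    int :=
  vlk m L.1 L.2 - vlk m L.2 L.1.

(* The oriented smoothing at x.  The incoming understrand is joined to the    *)
(* outgoing overstrand, so component one consists of the passages strictly    *)
(* after the overpass of x and before its underpass (arc c p q starts with p  *)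
(* and stops before q).                                                       *)
Definition smoothing (D : diagram) (x : nat) : seq passage * seq passage :=
  let p_over := if over (mark D) (x, true) then (x, true) else (x, false) in
  let p_under := opp p_over in
  (behead (arc (code D) p_over p_under), behead (arc (code D) p_under p_over)).

(* Laurent polynomials are taken in the field of fractions of Z[t]. *)
Definition tvar : {fraction {poly int}} := @FracField.tofrac {poly int} 'X.

Definition wriggle_polynomial (D : diagram) : {fraction {poly int}} :=
  \sum_(x <- crossings (code D) | is_classical (mark D x))
    (tvar ^ wriggle_number (mark D) (smoothing D x) - 1) *~ sgn (mark D x).

(* Vassiliev invariants. *)

Definition virtual_knot_invariant (A : Type) (nu : diagram -> A) : Prop :=
  forall D D', nonsingular D -> nonsingular D' -> same_knot D D' -> nu D = nu D'.

Definition singular_knot_invariant (A : Type) (nu : diagram -> A) : Prop :=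
  forall D D', same_knot D D' -> nu D = nu D'.

Definition resolve (x : nat) (s : bool) (D : diagram) : diagram :=
  Diagram (outer_left D)
    (fun y => if y == x then Classical s else mark D y) (codeP D).

Fixpoint resolve_all (A : zmodType) (nu : diagram -> A) (xs : seq nat)
    (D : diagram) : A :=
  if xs is x :: xs' then
    resolve_all nu xs' (resolve x true D) - resolve_all nu xs' (resolve x false D)
  else nu D.

(* The extension of nu; only the values of nu on nonsingular diagrams matter. *)
Definition extension (A : zmodType) (nu : diagram -> A) (D : diagram) : A :=
  resolve_all nu (double_points D) D.

Definition vassiliev_le (A : zmodType) (n : nat) (nu : diagram -> A) : Prop :=
  [/\ virtual_knot_invariant nu,
      singular_knot_invariant (extension nu)
    & forall D, (n < size (double_points D))%N -> extension nu D = 0].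

(* Main.v *)
From mathcomp Require Import all_boot all_order all_algebra.
From mathcomp Require Import zify ring.
Require Import Defs.

Set Implicit Arguments.
Unset Strict Implicit.
Unset Printing Implicit Defensive.

Import Order.TTheory GRing.Theory Num.Theory.
Local Open Scope ring_scope.

(** The exponent W(L_c) ignores the signs of the other crossings.  A classical
crossing d that links the two components of L_c contributes +1 when its passage
(d, true) lies on component one and -1 when it lies on component two: changing
the sign of d exchanges over and under and changes sgn d, and the two effects
cancel ([wriggle_number_weight]).  So W(L_c) is a chord index of the flat curve:
with weight +1 on (d, true), -1 on (d, false) and 0 on virtual passages, it is
the sum of the weights from the overpass of c to its underpass.  Changing the
sign of c exchanges the two components and changes W(L_c) into -W(L_c).

Hence each term sgn(c) (t^W(L_c) - 1) depends only on the sign of c and on data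
that no crossing change alters.  Resolving one double point x therefore kills
all terms but that of x, which becomes t^i + t^-i - 2 for i the chord index of
x, and resolving a second one kills this too ([resolve_one], [resolve_many]).
This gives order at most one.

For invariance, the weights along the code add up to a height function, and the
chord index of c is the difference of the heights before its underpass and after
its overpass ([chord_index]).  Up to a common shift and a relabelling, a move
alters heights only at the crossings that it involves, so the moves can be
checked together for every state sum of tau (mark of c) (chord index of c)
over the crossings c ([state_sum_move]).  Three choices of tau yield the number
of double points, the extension for one double point and the wriggle polynomial
([same_knot_state_sums]).

A trefoil diagram with one double, one positive and one virtual crossing has a
double point of chord index -1, and t^-1 + t - 2 is not 0, so the order is not
zero ([extension_trefoil]). *)

(** * Codes and crossings *)

Lemma oppK : involutive opp.
Proof. by case=> x b; rewrite /opp /= negbK. Qed.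

Lemma mem_crossings c x : (x \in crossings c) = ((x, true) \in c).
Proof.
apply/mapP/idP => [[[y b]]|xc]; last by exists (x, true); rewrite ?mem_filter.
by rewrite mem_filter /= => /andP[/= -> ?] ->.
Qed.

Lemma crossings_cat c1 c2 : crossings (c1 ++ c2) = crossings c1 ++ crossings c2.
Proof. by rewrite /crossings filter_cat map_cat. Qed.

Definition closed_code (c : seq passage) : bool :=
  uniq c && all (fun p => opp p \in c) c.

Lemma plane_closed c : plane_code c -> closed_code c.
Proof. by case/and3P=> uc cc _; rewrite /closed_code uc. Qed.

Lemma closed_opp c p : closed_code c -> (opp p \in c) = (p \in c).
Proof.
case/andP=> _ /allP cc; apply/idP/idP => [/cc|/cc//]; by rewrite oppK.
Qed.

Lemma closed_crossing c x b :
  closed_code c -> ((x, b) \in c) = (x \in crossings c).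
Proof.
move=> cc; rewrite mem_crossings; case: b => //.
by rewrite -(closed_opp (x, true) cc).
Qed.

Lemma uniq_crossings c : uniq c -> uniq (crossings c).
Proof.
move=> uc; rewrite map_inj_in_uniq ?filter_uniq // => -[x b] [y d].
by rewrite !mem_filter /= => /andP[/= -> _] /andP[/= -> _] ->.
Qed.

(** * Heights and chord indices *)

(** Double points count as classical crossings here, so that resolving them
leaves all weights unchanged. *)
Definition weight (m : nat -> marking) (p : passage) : int :=
  if m p.1 is Virtual then 0 else if p.2 then 1 else -1.

Definition height (m : nat -> marking) (c : seq passage) (p : passage) : int :=
  \sum_(q <- take (index p c) c) weight m q.

(** The sum of the weights strictly between p and opp p, going forward from p;
as all weights along a closed code add up to 0, the formula is also right when
opp p comes first (compare [wriggle_arcs]). *)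
Definition chord_index (m : nat -> marking) (c : seq passage) (p : passage) :
    int :=
  height m c (opp p) - height m c p - weight m p.

Lemma weight_opp m p : weight m (opp p) = - weight m p.
Proof.
by case: p => x b; rewrite /weight /=; case: (m x) => [s||]; case: b => //=;
   rewrite ?opprK ?oppr0.
Qed.

Lemma weight_negb m x b : weight m (x, ~~ b) = - weight m (x, b).
Proof. exact: (weight_opp m (x, b)). Qed.

Lemma height_cat m c1 c2 p : height m (c1 ++ c2) p =
  if p \in c1 then height m c1 p
  else \sum_(q <- c1) weight m q + height m c2 p.
Proof.
rewrite /height index_cat; case: ifP => pc1.
  by rewrite takel_cat // index_size.
by rewrite take_cat ltnNge leq_addr /= addKn big_cat.
Qed.

Lemma height_cons m q c p : height m (q :: c) p =
  if p == q then 0 else weight m q + height m c p.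
Proof.
rewrite /height /= eq_sym; case: eqP => _; first by rewrite big_nil.
by rewrite big_cons.
Qed.

Lemma chord_index_opp m c p : chord_index m c (opp p) = - chord_index m c p.
Proof. by rewrite /chord_index oppK weight_opp; ring. Qed.

Lemma chord_index_true m c x b :
  chord_index m c (x, b) = (-1) ^+ (~~ b) * chord_index m c (x, true).
Proof.
by case: b; rewrite ?mul1r // mulN1r -chord_index_opp.
Qed.

(** The weights of p and opp p cancel. *)
Lemma opp_stable_weight m c :
  closed_code c -> \sum_(q <- c) weight m q = 0.
Proof.
move=> cc; set t := \sum_(q <- c) _; suff : t = - t by lia.
have uc : uniq c by case/andP: cc.
have perm_opp : perm_eq c (map opp c).
  apply: uniq_perm => //; first by rewrite (map_inj_uniq (inv_inj oppK)).
  by move=> q; rewrite -{2}[q]oppK (mem_map (inv_inj oppK)) closed_opp.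
rewrite {1}/t (perm_big _ perm_opp) big_map -sumrN.
by apply: eq_bigr => q _; rewrite weight_opp.
Qed.

(** Moving the base point shifts all heights by the same constant. *)
Lemma chord_index_rot m n c p : closed_code c -> p \in c ->
  chord_index m (rot n c) p = chord_index m c p.
Proof.
rewrite /rot -{1 2 5}(cat_take_drop n c).
move: (take n c) (drop n c) => a b cc pc.
have tot := opp_stable_weight m cc; rewrite big_cat /= in tot.
have disj : {in b, forall q, q \notin a}.
  by apply/hasPn; case/andP: cc; rewrite cat_uniq => /and3P[].
have shift q : q \in a ++ b ->
    height m (b ++ a) q = height m (a ++ b) q + \sum_(r <- b) weight m r.
  rewrite mem_cat !height_cat; case: (boolP (q \in b)) => [qb _|_].
    by rewrite (negPf (disj _ qb)) addrAC tot add0r.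
  by rewrite orbF => ->; rewrite addrC.
by rewrite /chord_index !shift ?closed_opp //; ring.
Qed.

Lemma height_replace m u s s' v p :
    \sum_(q <- s) weight m q = \sum_(q <- s') weight m q ->
    p \notin s -> p \notin s' ->
  height m (u ++ s ++ v) p = height m (u ++ s' ++ v) p.
Proof. by move=> eqs /negPf ns /negPf ns'; rewrite !height_cat ns ns' eqs. Qed.

(** Seen from a crossing that it does not involve, each Reidemeister move and
each rigid vertex twist is a sequence of such replacements. *)
Lemma chord_index_replace m u s s' v p :
    \sum_(q <- s) weight m q = \sum_(q <- s') weight m q ->
    p.1 \notin unzip1 s -> p.1 \notin unzip1 s' ->
  chord_index m (u ++ s ++ v) p = chord_index m (u ++ s' ++ v) p.
Proof.
move=> eqs; have notin t q : q.1 \notin unzip1 t -> q \notin t.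
  by apply: contra => qt; apply/mapP; exists q.
by move=> ns ns'; rewrite /chord_index !(height_replace u v eqs) ?notin.
Qed.

Lemma eq_chord_index m m' c p : closed_code c -> p \in c ->
    {in crossings c, m =1 m'} -> chord_index m c p = chord_index m' c p.
Proof.
move=> cc pc eqm.
have eqw : {in c, weight m =1 weight m'}.
  by case=> x b xc; rewrite /weight /= eqm // -(closed_crossing _ b).
rewrite /chord_index eqw // /height.
by congr (_ - _ - _); apply: eq_big_seq => q /mem_take; apply: eqw.
Qed.

(** * State sums and the moves *)

Definition state_sum (A : zmodType) (tau : marking -> int -> A)
    (m : nat -> marking) (c : seq passage) : A :=
  \sum_(x <- crossings c) tau (m x) (chord_index m c (x, true)).

(** The conditions come from the moves in turn: the mixed move changes the index
of a virtual crossing; the crossing of R1 has index 0; classical crossings of R2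
have opposite signs and opposite indices; a rigid vertex twist negates the index
of the vertex. *)
Record move_compatible (A : zmodType) (tau : marking -> int -> A) : Prop := {
  virtual_term : forall i, tau Virtual i = 0;
  curl_term : forall s, tau (Classical s) 0 = 0;
  bigon_term : forall s i, tau (Classical s) i + tau (Classical (~~ s)) (- i) = 0;
  vertex_term : forall i, tau DoublePoint (- i) = tau DoublePoint i
}.

Lemma eq_state_sum (A : zmodType) (tau : marking -> int -> A) m m' c :
    closed_code c -> {in crossings c, m' =1 m} ->
  state_sum tau m c = state_sum tau m' c.
Proof.
move=> cc eqm; apply: eq_big_seq => x xc; rewrite eqm //; congr tau.
by apply/esym/eq_chord_index; rewrite // -mem_crossings.
Qed.

Lemma state_sum_rot (A : zmodType) (tau : marking -> int -> A) m n c :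
    closed_code c ->
  state_sum tau m (rot n c) = state_sum tau m c.
Proof.
move=> cc; have pr : perm_eq (crossings (rot n c)) (crossings c).
  by rewrite /crossings perm_map // perm_filter // perm_rot.
rewrite /state_sum (perm_big _ pr); apply: eq_big_seq => x.
by rewrite mem_crossings => xc; rewrite chord_index_rot.
Qed.

Lemma height_relabel m m' (f : nat -> nat) c p :
    let g := fun p : passage => (f p.1, p.2) in
    {in p :: c &, injective g} -> {in c, forall q, m' (f q.1) = m q.1} ->
  height m' (map g c) (g p) = height m c p.
Proof.
move=> g; elim: c => [|q c IH] injg eqm /=; first by rewrite /height !big_nil.
rewrite !height_cons.
rewrite (inj_in_eq injg) ?inE ?eqxx ?orbT //; case: eqP => // _.
congr (_ + _); first by rewrite /weight /= eqm // inE eqxx.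
apply: IH => [a b|a ac]; last by rewrite eqm // inE ac orbT.
by rewrite !inE => ha hb; apply: injg; rewrite !inE;
   [case/orP: ha | case/orP: hb] => ->; rewrite ?orbT.
Qed.

(** The relabelling need not be injective a priori, but it is on the labels in
use because the new code has no repeated passage. *)
Lemma state_sum_relabel (A : zmodType) (tau : marking -> int -> A)
    m m' (f : nat -> nat) c :
    let c' := [seq (f p.1, p.2) | p <- c] in
    closed_code c -> closed_code c' ->
    {in crossings c, forall x, m' (f x) = m x} ->
  state_sum tau m c = state_sum tau m' c'.
Proof.
move=> c' cc cc' eqm; have eqc : crossings c' = map f (crossings c).
  by rewrite /crossings /c' filter_map -!map_comp.
have injg : {in c &, injective (fun p : passage => (f p.1, p.2))}.
  have uc' : uniq c' by case/andP: cc'.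
  move=> p q pc qc eqg; rewrite -(nth_index p pc) -(nth_index p qc).
  congr nth; apply/eqP; rewrite -(nth_uniq (f p.1, p.2) _ _ uc') ?size_map ?index_mem //.
  by rewrite !(nth_map p) ?index_mem // !nth_index //; apply/eqP.
have eqm' : {in c, forall q, m' (f q.1) = m q.1}.
  by case=> x b xc; rewrite eqm // -(closed_crossing _ b).
have eqh p : p \in c -> height m' c' (f p.1, p.2) = height m c p.
  move=> pc; apply: height_relabel => // a b; rewrite !inE => ha hb.
  by apply: injg; [move: ha | move: hb] => /orP[/eqP->|].
rewrite /state_sum eqc [RHS]big_map; apply: eq_big_seq => x xc; rewrite eqm //.
move: xc; rewrite mem_crossings => xc.
congr tau; rewrite /chord_index (eqh (x, true)) // (eqh (x, false)) //.
  by rewrite /weight /= (eqm' _ xc).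
by rewrite (closed_opp (x, true) cc).
Qed.

(** Nothing lies between the two passages of the new crossing, whose index is
therefore 0, and their weights cancel for every other crossing. *)
Lemma state_sum_curl (A : zmodType) (tau : marking -> int -> A) m u v x b :
    move_compatible tau -> uniq (u ++ [:: (x, b); (x, ~~ b)] ++ v) ->
    m x <> DoublePoint ->
  state_sum tau m (u ++ v) = state_sum tau m (u ++ [:: (x, b); (x, ~~ b)] ++ v).
Proof.
move=> mw; set S := [:: _; _] => uc mx.
have pr : perm_eq (crossings (u ++ S ++ v)) (x :: crossings (u ++ v)).
  by apply/permP => P; rewrite -cat1s !(crossings_cat, count_cat) /S;
     case: (b) => /=; lia.
have := uc; rewrite (perm_uniq (permEl (perm_catCA _ _ _))) cat_uniq.
case/and3P=> _ /hasPn disj _.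
rewrite /state_sum (perm_big _ pr) big_cons /=.
rewrite [X in X + _](_ : _ = 0) ?add0r.
  apply: eq_big_seq => t; rewrite mem_crossings => tuv; congr tau.
  apply/esym/(@chord_index_replace _ _ S [::]) => //.
    by rewrite !big_cons big_nil weight_negb addr0 subrr.
  have : t != x; last by rewrite /S /= !inE orbb.
  apply: contraL (disj _ tuv) => /eqP ->; rewrite negbK /S !inE.
  by rewrite !xpair_eqE eqxx; case: (b).
have xu d : (x, d) \in u = false.
  apply/negP => xu; have := disj (x, d); rewrite mem_cat xu => /(_ isT).
  by rewrite /S !inE !xpair_eqE eqxx; case: (b); case: (d).
have -> : chord_index m (u ++ S ++ v) (x, true) = 0.
  apply: (@mulfI _ ((-1) ^+ (~~ b))); first by rewrite signr_eq0.
  rewrite mulr0 -chord_index_true.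
  rewrite /chord_index /opp /= !height_cat !xu /S.
  rewrite !height_cons !xpair_eqE !eqxx; case: (b) => /=; ring.
by case: (m x) mx => [s||] // _; [apply: curl_term | apply: virtual_term].
Qed.

(** * Bigons: R2 and the rigid vertex twist *)

Lemma bigon_fresh par u v w x y b :
    uniq (u ++ strand1 x y b ++ v ++ strand2 par x y b ++ w) ->
  x != y /\ forall d, (x, d) \notin u ++ v ++ w /\ (y, d) \notin u ++ v ++ w.
Proof.
set c := u ++ _; have pr : perm_eq c
    ((strand1 x y b ++ strand2 par x y b) ++ u ++ v ++ w).
  by apply/permP => P; rewrite /c !count_cat; lia.
rewrite (perm_uniq pr) cat_uniq => /and3P[uS /hasPn disj _]; split.
  by apply/eqP => exy; move: uS; rewrite exy; case: (par);
     rewrite /= !inE eqxx ?orbT.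
by move=> d; split; apply/negP => /disj; case: (par); case: (b); case: d;
   rewrite /= !inE eqxx ?orbT.
Qed.

(** In R2 this shows that the indices at (x, true) and (y, true) are opposite.
The value i is symmetric in x and y, as these have the same weights; after a
twist it is the index at (x, ~~ b) instead of (x, b), and so the twist negates
the index of the vertex. *)
Lemma bigon_index m par u v w x y b :
    let c := u ++ strand1 x y b ++ v ++ strand2 par x y b ++ w in
    let i := \sum_(q <- v) weight m q - (if par then weight m (x, b) else 0) in
    uniq c -> (forall d, weight m (x, d) = weight m (y, d)) ->
  chord_index m c (x, b) = i /\ chord_index m c (y, ~~ b) = i.
Proof.
move=> c i uc ew; have [xy fr] := bigon_fresh uc.
have frE d : (((x, d) \in u = false) * ((x, d) \in v = false) *
    ((y, d) \in u = false) * ((y, d) \in v = false))%type.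
  have [] := fr d; rewrite !mem_cat !negb_or => /and3P[? ? _] /and3P[? ? _].
  by do !split; apply/negbTE.
rewrite /c /i /chord_index /opp /= negbK.
case: (par); case: (b); rewrite /strand1 /strand2 /=;
  rewrite !(height_cat, height_cons, frE) !xpair_eqE !eqxx ?(eq_sym y x);
  rewrite (negPf xy) /= -!ew ?(weight_negb m x true); split; ring.
Qed.

Lemma bigon_sum m par x y b :
    (forall d, weight m (x, d) = weight m (y, d)) ->
  \sum_(q <- strand1 x y b) weight m q = 0 /\
  \sum_(q <- strand2 par x y b) weight m q = 0.
Proof.
move=> ew; case: par; rewrite /strand1 /strand2 !big_cons !big_nil;
by rewrite !weight_negb !ew !addr0 ?subrr ?addNr.
Qed.

Lemma chord_index_erase_bigon m par u v w x y b t :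
    (forall d, weight m (x, d) = weight m (y, d)) -> t != x -> t != y ->
  chord_index m (u ++ strand1 x y b ++ v ++ strand2 par x y b ++ w) (t, true) =
  chord_index m (u ++ v ++ w) (t, true).
Proof.
move=> ew tx ty; have [s1 s2] := bigon_sum par b ew.
rewrite (@chord_index_replace _ u _ [::]) ?s1 ?big_nil //=; last first.
  by rewrite !inE negb_or tx.
rewrite /= [u ++ v ++ strand2 _ _ _ _ ++ w]catA.
rewrite (@chord_index_replace _ (u ++ v) _ [::]) ?s2 ?big_nil -?catA //=.
by case: (par); rewrite /= !inE negb_or tx ty.
Qed.

Lemma state_sum_bigon (A : zmodType) (tau : marking -> int -> A) m
    par u v w x y b :
    let c := u ++ strand1 x y b ++ v ++ strand2 par x y b ++ w in
    move_compatible tau -> uniq c ->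
    (exists s, m x = Classical s /\ m y = Classical (~~ s))
      \/ (m x = Virtual /\ m y = Virtual) ->
  state_sum tau m (u ++ v ++ w) = state_sum tau m c.
Proof.
move=> c mw uc mxy; have [xy fr] := bigon_fresh uc.
have ew d : weight m (x, d) = weight m (y, d).
  by rewrite /weight /=; case: mxy => [[s [-> ->]]|[-> ->]].
have pr : perm_eq (crossings c) ([:: x; y] ++ crossings (u ++ v ++ w)).
  by apply/permP => P; rewrite /c !(crossings_cat, count_cat) /strand1 /strand2;
     case: (par); case: (b) => /=; lia.
rewrite /state_sum (perm_big _ pr) big_cat /= !big_cons big_nil /=.
have [ix iy] := bigon_index uc ew.
rewrite [X in X + _](_ : _ = 0) ?add0r.
  apply: eq_big_seq => t; rewrite mem_crossings => tc; congr tau.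
  rewrite chord_index_erase_bigon //; apply/eqP => et; move: tc; rewrite et;
  by apply/negP; case: (fr true).
have -> : chord_index m c (y, true) = - chord_index m c (x, true).
  have := etrans iy (esym ix); rewrite -/c.
  rewrite (chord_index_true _ _ y (~~ b)) (chord_index_true _ _ x b).
  by case: (b); rewrite !(mul1r, mulN1r) => <-; rewrite ?opprK.
rewrite addr0; case: mxy => [[s [-> ->]]|[-> ->]]; first exact: bigon_term.
by rewrite !virtual_term // addr0.
Qed.

(** The index of the classical crossing y is negated although its sign stays the
same; this is harmless since classical crossings are not counted by tau. *)
Lemma state_sum_twist (A : zmodType) (tau : marking -> int -> A) m
    par u v w x y b :
    let c := u ++ strand1 x y b ++ v ++ strand2 par x y b ++ w in
    let c' := u ++ strand1 y x b ++ v ++ strand2 par y x b ++ w in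
    move_compatible tau -> (forall s i, tau (Classical s) i = 0) ->
    uniq c -> uniq c' -> m x = DoublePoint -> is_classical (m y) ->
  state_sum tau m c = state_sum tau m c'.
Proof.
move=> c c' mw tauC uc uc' mx my; have [xy _] := bigon_fresh uc.
have ew d : weight m (x, d) = weight m (y, d).
  by rewrite /weight /= mx; case: (m y) my.
have pr : perm_eq (crossings c') (crossings c).
  by apply/permP => P; rewrite !(crossings_cat, count_cat) /strand1 /strand2;
     case: (par); case: (b) => /=; lia.
rewrite /state_sum (perm_big _ pr); apply: eq_bigr => t _.
have [->|tx] := eqVneq t x.
  have [ix _] := bigon_index uc ew.
  have [_ ix'] := bigon_index uc' (fun d => esym (ew d)).
  rewrite mx -(vertex_term mw); congr tau.
  have : chord_index m c (x, b) = chord_index m c' (x, ~~ b).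
    by rewrite ix ix' ew.
  rewrite (chord_index_true _ _ x b) (chord_index_true _ _ x (~~ b)).
  by case: (b); rewrite !(mul1r, mulN1r) => e; rewrite ?e ?opprK.
have [->|ty] := eqVneq t y.
  by case: (m y) my => // s _; rewrite !tauC.
congr tau; rewrite /c /c' !chord_index_erase_bigon // => d; exact/esym/ew.
Qed.

(** * Triangles: R3 and the mixed moves *)

Definition strand (d : bool) (p q : passage) : seq passage :=
  if d then [:: p; q] else [:: q; p].

(** Other blocks may be reversed too: the prefixes u and u' are only required to
have the same total weight, so that s starts at the same height in c and c'. *)
Definition reversed_at (m : nat -> marking) (c c' s : seq passage) : Prop :=
  exists u v u' v', [/\ c = u ++ s ++ v, c' = u' ++ rev s ++ v'
    & \sum_(q <- u) weight m q = \sum_(q <- u') weight m q].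

Lemma height_reversed m c c' d p q :
    uniq c -> uniq c' -> reversed_at m c c' (strand d p q) ->
  height m c' p = height m c p + (if d then weight m q else - weight m q) /\
  height m c' q = height m c q - (if d then weight m p else - weight m p).
Proof.
move=> uc uc' [u [v [u' [v' [ec ec' eu]]]]].
have fresh a : uniq (a ++ strand d p q ++ [::]) ->
    [/\ p != q, p \in a = false & q \in a = false].
  rewrite cat_uniq => /and3P[_ /hasPn disj us]; split.
  - by apply: contraTneq us => ->; rewrite /strand; case: (d); rewrite /= inE eqxx.
  - by apply/negbTE/disj; rewrite /strand; case: (d); rewrite !inE eqxx ?orbT.
  - by apply/negbTE/disj; rewrite /strand; case: (d); rewrite !inE eqxx ?orbT.
have [|pq pu qu] := fresh u.
  by move: uc; rewrite ec cats0 catA cat_uniq => /and3P[].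
have [|_ pu' qu'] := fresh u'.
  move: uc'; rewrite ec' catA cat_uniq cats0 => /and3P[+ _ _].
  by rewrite !cat_uniq (eq_has_r (mem_rev _)) rev_uniq.
rewrite ec ec' /strand; case: (d); rewrite /= !(height_cat, height_cons);
by rewrite pu qu pu' qu' !eqxx ?(eq_sym q p) (negPf pq) eu; split; ring.
Qed.

(** Write e1, e2, e3 = 1 or -1 for d1, d2, d3.  At the corner x the height on A
changes by plus or minus the weight of z and that on B by plus or minus the
weight of y; with the orientations of the triangle the index changes by
e3 (r(y) - r(z)), up to sign, where r is 1 or 0 according to whether the corner
is non-virtual or virtual. *)
Lemma triangle_corner m c c' d1 d2 d3 x y z A B C :
    uniq c -> uniq c' -> triangle d1 d2 d3 x y z A B C ->
    reversed_at m c c' A -> reversed_at m c c' B ->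
    weight m (y, true) = weight m (z, true) ->
  chord_index m c' (x, true) = chord_index m c (x, true).
Proof.
move=> uc uc' [eA eB _]; rewrite eA eB => /(height_reversed uc uc')[_ hA].
move=> /(height_reversed uc uc')[hB _] eyz.
apply: (@mulfI _ ((-1) ^+ (~~ (d1 == d2)))); first by rewrite signr_eq0.
rewrite -!chord_index_true.
rewrite /chord_index /opp /=.
rewrite hA hB; move: eyz; case: (d1); case: (d2); case: (d3) => /= eyz;
  rewrite ?(weight_negb m _ true) ?eyz; ring.
Qed.

(** A slidable triangle has zero, two or three virtual corners.  With exactly one
virtual corner (a forbidden move) the indices of the two others would change. *)
Lemma slidable_weight d1 d2 d3 x y z m : slidable d1 d2 d3 x y z m ->
  [/\ m x <> Virtual -> weight m (y, true) = weight m (z, true),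
      m y <> Virtual -> weight m (z, true) = weight m (x, true)
    & m z <> Virtual -> weight m (x, true) = weight m (y, true)].
Proof.
by rewrite /slidable /weight /=; case: (m x); case: (m y); case: (m z).
Qed.

Lemma state_sum_triangle (A : zmodType) (tau : marking -> int -> A) m
    d1 d2 d3 x y z s1 s2 s3 u1 u2 u3 u4 :
    let c := u1 ++ s1 ++ u2 ++ s2 ++ u3 ++ s3 ++ u4 in
    let c' := u1 ++ rev s1 ++ u2 ++ rev s2 ++ u3 ++ rev s3 ++ u4 in
    move_compatible tau -> uniq c -> uniq c' ->
    triangle d1 d2 d3 x y z s1 s2 s3 \/ triangle d1 d2 d3 x y z s1 s3 s2 ->
    slidable d1 d2 d3 x y z m ->
  state_sum tau m c = state_sum tau m c'.
Proof.
move=> c c' mw uc uc' tri slid.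
have eqrev s : \sum_(q <- rev s) weight m q = \sum_(q <- s) weight m q.
  by apply: perm_big; rewrite perm_rev.
have pr : perm_eq (crossings c') (crossings c).
  have crev s : crossings (rev s) = rev (crossings s).
    by rewrite /crossings filter_rev map_rev.
  by apply/permP => P; rewrite !(crossings_cat, count_cat) !crev !count_rev.
have r1 : reversed_at m c c' s1.
  by exists u1, (u2 ++ s2 ++ u3 ++ s3 ++ u4), u1, (u2 ++ rev s2 ++ u3 ++ rev s3 ++ u4).
have r2 : reversed_at m c c' s2.
  exists (u1 ++ s1 ++ u2), (u3 ++ s3 ++ u4), (u1 ++ rev s1 ++ u2), (u3 ++ rev s3 ++ u4).
  by rewrite /c /c' -!catA !big_cat /= eqrev.
have r3 : reversed_at m c c' s3.
  exists (u1 ++ s1 ++ u2 ++ s2 ++ u3), u4, (u1 ++ rev s1 ++ u2 ++ rev s2 ++ u3), u4.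
  by rewrite /c /c' -!catA !big_cat /= !eqrev.
(* A triangle may be read from any corner, so the corner x is enough. *)
have rot3 a1 a2 a3 p q r S1 S2 S3 : triangle a1 a2 a3 p q r S1 S2 S3 ->
    triangle a2 a3 a1 q r p S2 S3 S1.
  by case=> -> -> ->.
have [hx hy hz] := slidable_weight slid.
have corner t (P : m t <> Virtual ->
    chord_index m c' (t, true) = chord_index m c (t, true)) :
    tau (m t) (chord_index m c (t, true)) =
    tau (m t) (chord_index m c' (t, true)).
  case: (m t) P => [s||] P; last by rewrite P.
  - by rewrite P.
  - by rewrite !virtual_term.
rewrite /state_sum (perm_big _ pr); apply: eq_bigr => t _.
have [->|tx] := eqVneq t x.
  by apply: corner => /hx; case: tri => tri; apply: triangle_corner tri _ _.
have [->|ty] := eqVneq t y.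
  by apply: corner => /hy; case: tri => /rot3 tri; apply: triangle_corner tri _ _.
have [->|tz] := eqVneq t z.
  by apply: corner => /hz; case: tri => /rot3/rot3 tri; apply: triangle_corner tri _ _.
have nots s : s \in [:: s1; s2; s3] -> t \notin unzip1 s.
  by rewrite !inE; case: tri => -[e1 e2 e3] /or3P[] /eqP ->;
     rewrite ?e1 ?e2 ?e3; case: (d1); case: (d2); case: (d3);
     rewrite /= !inE negb_or ?tx ?ty ?tz.
have nots' s : s \in [:: s1; s2; s3] -> t \notin unzip1 (rev s).
  by move=> /nots; rewrite /unzip1 map_rev mem_rev.
have rep u s v : s \in [:: s1; s2; s3] ->
    chord_index m (u ++ s ++ v) (t, true) =
    chord_index m (u ++ rev s ++ v) (t, true).
  move=> si; apply: chord_index_replace; first by rewrite eqrev.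
    exact: nots.
  exact: nots'.
have e2 := rep (u1 ++ rev s1 ++ u2) s2 (u3 ++ s3 ++ u4).
have e3 := rep (u1 ++ rev s1 ++ u2 ++ rev s2 ++ u3) s3 u4.
rewrite -!catA in e2 e3.
by congr tau; rewrite /c /c' rep ?e2 ?e3 // !inE eqxx ?orbT.
Qed.

(** * Invariance of state sums *)

Lemma eq_slidable d1 d2 d3 x y z m m' :
    m' x = m x -> m' y = m y -> m' z = m z ->
  slidable d1 d2 d3 x y z m' = slidable d1 d2 d3 x y z m.
Proof. by rewrite /slidable /over /= => -> -> ->. Qed.

Lemma triangle_crossings d1 d2 d3 x y z A B C c :
    triangle d1 d2 d3 x y z A B C -> closed_code c -> {subset A ++ B <= c} ->
  [/\ x \in crossings c, y \in crossings c & z \in crossings c].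
Proof.
case=> -> -> _ cc sub; split.
- rewrite -(closed_crossing x (d1 == d2) cc); apply: sub.
  by case: (d1); case: (d2); case: (d3); rewrite /= !inE !eqxx ?orbT.
- rewrite -(closed_crossing y (d2 == d3) cc); apply: sub.
  by case: (d1); case: (d2); case: (d3); rewrite /= !inE !eqxx ?orbT.
- rewrite -(closed_crossing z (d3 != d1) cc); apply: sub.
  by case: (d1); case: (d2); case: (d3); rewrite /= !inE !eqxx ?orbT.
Qed.

(** A rigid vertex twist negates the index of a classical crossing, so tau must
either ignore classical crossings or be evaluated where no twist applies. *)
Lemma state_sum_move (A : zmodType) (tau : marking -> int -> A) D D' :
    move_compatible tau ->
    (forall s i, tau (Classical s) i = 0) \/ nonsingular D ->
    move D D' ->
  state_sum tau (mark D) (code D) = state_sum tau (mark D') (code D').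
Proof.
move=> mw tauC mv; have cc := plane_closed (codeP D).
have cc' := plane_closed (codeP D'); have uc' : uniq (code D') by case/andP: cc'.
have uc : uniq (code D) by case/andP: cc.
case: mv => [f _ ec eqm|k i _ ec _ eqm|u v x b _ ec ec' mx eqm
    |par u v w x y b _ ec ec' mxy eqm|d1 d2 d3 x y z s1 s2 s3 u1 u2 u3 u4 _ tri slid ec ec' eqm
    |par u v w x y b _ mx my ec ec' eqm].
- by rewrite ec; apply: state_sum_relabel; rewrite -?ec.
- by rewrite ec state_sum_rot // (eq_state_sum _ cc eqm).
- rewrite (eq_state_sum _ cc eqm) ec ec'; apply: state_sum_curl => //.
  by rewrite -ec'.
- rewrite (eq_state_sum _ cc eqm) ec ec'; apply: state_sum_bigon => //.
  by rewrite -ec'.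
- have [xc yc zc] : [/\ x \in crossings (code D), y \in crossings (code D)
      & z \in crossings (code D)].
    by case: tri => tri; apply: (triangle_crossings tri) => // p;
       rewrite ec !mem_cat => /orP[] ->; rewrite ?orbT.
  rewrite (eq_state_sum _ cc eqm) ec ec'; apply: state_sum_triangle tri _ => //.
  + by rewrite -ec.
  + by rewrite -ec'.
  + by rewrite (eq_slidable _ _ _ (m := mark D)) ?eqm.
- have [xc yc] : x \in crossings (code D) /\ y \in crossings (code D).
    rewrite -(closed_crossing x b cc) -(closed_crossing y (~~ b) cc) ec.
    by split; rewrite !mem_cat !inE eqxx ?orbT.
  case: tauC => [tauC|]; last first.
    move=> ns; have : x \in double_points D by rewrite mem_filter mx.
    by rewrite ns.
  rewrite (eq_state_sum _ cc eqm) ec ec'; apply: state_sum_twist => //.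
  + by rewrite -ec.
  + by rewrite -ec'.
  + by rewrite eqm.
  + by rewrite eqm.
Qed.

(** * The wriggle number of a smoothing *)

Lemma sum_opp_stable m s : uniq s ->
  \sum_(p <- s | opp p \in s) weight m p = 0.
Proof.
move=> us; rewrite -big_filter; apply: opp_stable_weight.
rewrite /closed_code filter_uniq //; apply/allP => p.
by rewrite !mem_filter oppK andbC.
Qed.

Lemma vlk_weight m L1 L2 : vlk m L1 L2 =
  \sum_(p <- L1 | over m p && (opp p \in L2)) weight m p.
Proof.
apply: eq_bigr => -[x b] /andP[+ _]; rewrite /over /weight /=.
by case: (m x) => // s /eqP ->.
Qed.

(** Passages of L1 that go over contribute their sign, which is their weight.
The underpasses of L1 contribute through vlk(L2, L1): the opposite passage goes
over, and its weight is the opposite one. *)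
Lemma wriggle_number_weight m L1 L2 :
    uniq L1 -> uniq L2 ->
    {in L1, forall p, m p.1 <> DoublePoint} ->
  wriggle_number m (L1, L2) = \sum_(p <- L1 | opp p \in L2) weight m p.
Proof.
move=> u1 u2 nd; rewrite /wriggle_number !vlk_weight /= [RHS](bigID (over m)) /=.
congr (_ + _); first by apply: eq_bigl => p; rewrite andbC.
have pr : perm_eq [seq p <- L2 | opp p \in L1] [seq opp p | p <- L1 & opp p \in L2].
  apply: uniq_perm => [||q].
  - exact: filter_uniq.
  - by rewrite (map_inj_uniq (inv_inj oppK)) filter_uniq.
  - by rewrite -[q in RHS]oppK (mem_map (inv_inj oppK)) !mem_filter oppK andbC.
rewrite (eq_bigl (fun p => (opp p \in L1) && over m p)); last first.
  by move=> p; rewrite andbC.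
rewrite -big_filter_cond (perm_big _ pr) big_map big_filter_cond /= -sumrN.
rewrite big_mkcond [RHS]big_mkcond; apply: eq_big_seq => p /nd.
rewrite weight_opp opprK; case: p => x b; rewrite /over /weight /=.
case: (m x) => [s _||] //; last by rewrite !if_same.
by case: (_ \in _) => //=; case: s; case: b.
Qed.

(** Crossings of component one with itself contribute 0 to the sum of the weights
along that component, and so only the linking crossings remain. *)
Lemma wriggle_arcs m c p : closed_code c -> p \in c ->
    {in c, forall q, m q.1 <> DoublePoint} ->
  wriggle_number m (behead (arc c p (opp p)), behead (arc c (opp p) p)) =
  chord_index m c p.
Proof.
move=> cc pc nd; have uc : uniq c by case/andP: cc.
have np : p != opp p by case: (p) => x b; rewrite xpair_eqE eqxx; case: b.
have op : opp p \in c by rewrite closed_opp.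
case: (rot_to_arc uc pc op np) => i v u <- <- er /=.
rewrite -(chord_index_rot m i cc pc) er.
have mem q : (q \in c) = (q \in p :: v ++ opp p :: u) by rewrite -er mem_rot.
have : uniq (p :: v ++ opp p :: u) by rewrite -er rot_uniq.
rewrite /= mem_cat inE cat_uniq /= !negb_or => /andP[/and3P[pv _ pu]].
case/and3P=> uv /andP[ov /hasPn disj] /andP[ou uu].
rewrite wriggle_number_weight //; last first.
  by move=> q qv; apply: nd; rewrite mem inE mem_cat qv orbT.
(* With the base point at p, the index of p is the weight of component one. *)
rewrite /chord_index !height_cons eqxx (eq_sym (opp p)) (negPf np) height_cat.
rewrite (negPf ov) height_cons eqxx.
transitivity (\sum_(q <- v) weight m q); last by ring.
rewrite [RHS](bigID (fun q => opp q \in v)) /= sum_opp_stable // add0r.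
rewrite big_mkcond [RHS]big_mkcond; apply: eq_big_seq => q qv; congr (if _ then _ else _).
have qc : opp q \in c by rewrite closed_opp // mem inE mem_cat qv orbT.
have qp : q != p by apply: contraNneq pv => <-.
have qop : q != opp p by apply: contraNneq ov => <-.
have oqv : (opp q \in v) || (opp q \in u).
  move: qc; rewrite mem inE mem_cat inE !(inv_eq oppK) oppK.
  by rewrite (negPf qop) (negPf qp).
apply/idP/idP => [/disj //|noqv]; by move: oqv; rewrite (negPf noqv).
Qed.

Lemma nonsingular_mark D p : nonsingular D -> p \in code D ->
  mark D p.1 <> DoublePoint.
Proof.
case: p => x b ns xc mx; have : x \in double_points D; last by rewrite ns.
by rewrite mem_filter mx -(closed_crossing x b (plane_closed (codeP D))).
Qed.

Lemma wriggle_number_smoothing D x s :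
    nonsingular D -> x \in crossings (code D) -> mark D x = Classical s ->
  wriggle_number (mark D) (smoothing D x) = chord_index (mark D) (code D) (x, s).
Proof.
move=> ns xc mx; have cc := plane_closed (codeP D).
have xsc : (x, s) \in code D by rewrite closed_crossing.
rewrite -(wriggle_arcs cc xsc (fun q => @nonsingular_mark D q ns)).
by rewrite /smoothing /over mx /=; case: (s).
Qed.

(** * The wriggle polynomial as a state sum *)

Definition classical_term (m : marking) (i : int) : {fraction {poly int}} :=
  if is_classical m then (tvar ^ (sgn m * i) - 1) *~ sgn m else 0.

Definition double_term (m : marking) (i : int) : {fraction {poly int}} :=
  if is_double m then tvar ^ i + tvar ^ (- i) - 2 else 0.

Definition count_term (m : marking) (i : int) : int :=
  if is_double m then 1 else 0.

Lemma classical_compatible : move_compatible classical_term.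
Proof.
split=> [//|s|s i|//]; rewrite /classical_term /=; case: s => /=;
  by rewrite ?mulr0 ?subrr ?mul0rz // !(mul1r, mulN1r) ?opprK mulrNz mulr1z
             ?subrr ?addNr.
Qed.

Lemma double_compatible : move_compatible double_term.
Proof.
split=> [//|//|s i|i]; rewrite /double_term /= ?addr0 //.
by rewrite opprK [tvar ^ (- i) + _]addrC.
Qed.

Lemma count_compatible : move_compatible count_term.
Proof. by split=> // s i; rewrite /count_term /= addr0. Qed.

Lemma size_double_points D :
  (size (double_points D))%:Z = state_sum count_term (mark D) (code D).
Proof.
rewrite size_filter -sum1_count [in LHS]big_mkcond /=.
rewrite (big_morph Posz PoszD (erefl _)).
by apply: eq_bigr => x _; rewrite /count_term; case: (is_double _).
Qed.

Lemma wriggle_polynomial_state_sum D : nonsingular D ->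
  wriggle_polynomial D = state_sum classical_term (mark D) (code D).
Proof.
move=> ns; rewrite /wriggle_polynomial big_mkcond; apply: eq_big_seq => x xc.
rewrite /classical_term; case e : (mark D x) => [s||] //=.
rewrite (wriggle_number_smoothing ns xc e) (chord_index_true _ _ x s).
by case: (s).
Qed.

(** * Resolution of double points *)

Lemma double_points_resolve D x s : double_points (resolve x s D) =
  [seq y <- double_points D | y != x].
Proof.
rewrite /double_points -filter_predI; apply: eq_filter => y /=.
by case: eqP.
Qed.

Lemma double_points_resolve_cons D x xs s :
  double_points D = x :: xs -> double_points (resolve x s D) = xs.
Proof.
move=> e; have : uniq (double_points D).
  by rewrite filter_uniq // uniq_crossings //; case/andP: (plane_closed (codeP D)).
rewrite double_points_resolve e /= eqxx /= => /andP[xxs _].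
by apply/all_filterP/allP => y yxs; apply: contraNneq xxs => <-.
Qed.

Lemma chord_index_resolve D x s p : mark D x = DoublePoint ->
  chord_index (mark (resolve x s D)) (code D) p = chord_index (mark D) (code D) p.
Proof.
move=> mx.
have ew q : weight (mark (resolve x s D)) q = weight (mark D) q.
  by rewrite /weight /=; case: eqP => // ->; rewrite mx.
by rewrite /chord_index /height ew; congr (_ - _ - _); apply: eq_bigr => q _.
Qed.

(** The positive and the negative resolution have the same terms away from x,
and at x they give (t^i - 1) and -(t^-i - 1). *)
Lemma resolve_one D x : double_points D = [:: x] ->
  resolve_all wriggle_polynomial [:: x] D =
  tvar ^ chord_index (mark D) (code D) (x, true)
  + tvar ^ (- chord_index (mark D) (code D) (x, true)) - 2.
Proof.
move=> dpx; have : x \in double_points D by rewrite dpx inE.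
rewrite mem_filter => /andP[dx xc].
have mx : mark D x = DoublePoint by case: (mark D x) dx.
have uxs : uniq (crossings (code D)).
  by rewrite uniq_crossings //; case/andP: (plane_closed (codeP D)).
rewrite /= !wriggle_polynomial_state_sum /nonsingular ?(double_points_resolve_cons _ dpx) //.
rewrite /state_sum /= !(bigD1_seq x) //= eqxx !(chord_index_resolve _ _ mx).
have same s : \sum_(y <- crossings (code D) | y != x)
      classical_term (if y == x then Classical s else mark D y)
        (chord_index (mark (resolve x s D)) (code D) (y, true)) =
    \sum_(y <- crossings (code D) | y != x)
      classical_term (mark D y) (chord_index (mark D) (code D) (y, true)).
  by apply: eq_bigr => y /negPf ->; rewrite chord_index_resolve.
rewrite !same opprD addrACA subrr addr0 /classical_term /= mul1r mulN1r mulr1z mulrNz mulr1z.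
by rewrite opprK; ring.
Qed.

Lemma resolve_cons (A : zmodType) (nu : diagram -> A) x xs D :
  resolve_all nu (x :: xs) D =
  resolve_all nu xs (resolve x true D) - resolve_all nu xs (resolve x false D).
Proof. by []. Qed.

(** By [resolve_one] the value for a single double point y depends only on the
index of y, which is the same for both resolutions of x. *)
Lemma resolve_many x y xs D : double_points D = [:: x, y & xs] ->
  resolve_all wriggle_polynomial [:: x, y & xs] D = 0.
Proof.
elim: xs x y D => [|z xs IH] x y D dpD; rewrite resolve_cons.
  have mx : mark D x = DoublePoint.
    have : x \in double_points D by rewrite dpD inE eqxx.
    by rewrite mem_filter; case: (mark D x).
  rewrite !resolve_one ?(double_points_resolve_cons _ dpD) //=.
  by rewrite !(chord_index_resolve _ _ mx) subrr.
by rewrite !IH ?(double_points_resolve_cons _ dpD) // subrr.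
Qed.

Lemma extension_nonsingular D : nonsingular D ->
  extension wriggle_polynomial D = state_sum classical_term (mark D) (code D).
Proof.
by move=> ns; rewrite /extension ns /= wriggle_polynomial_state_sum.
Qed.

Lemma extension_one_double D : size (double_points D) = 1 ->
  extension wriggle_polynomial D = state_sum double_term (mark D) (code D).
Proof.
rewrite /extension; case dpD : (double_points D) => [|x [|y xs]] // _.
rewrite resolve_one // /state_sum /double_term -big_mkcond -big_filter.
by rewrite -/(double_points D) dpD big_seq1.
Qed.

Lemma extension_many_double D : (1 < size (double_points D))%N ->
  extension wriggle_polynomial D = 0.
Proof.
rewrite /extension; case dpD : (double_points D) => [|x [|y xs]] // _.
exact: resolve_many.
Qed.

(** * Invariance of the extension *)

(** Nonsingularity is carried along a chain of moves by the number of double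
points, which makes the third conclusion pass through transitivity. *)
Lemma same_knot_state_sums D D' : same_knot D D' ->
  [/\ size (double_points D) = size (double_points D'),
      state_sum double_term (mark D) (code D) =
      state_sum double_term (mark D') (code D')
    & nonsingular D -> state_sum classical_term (mark D) (code D) =
                       state_sum classical_term (mark D') (code D')].
Proof.
have nsE E : nonsingular E <-> size (double_points E) = 0.
  by split=> [->|/size0nil].
elim=> {D D'} [D D' mv|D|D D' _ [n d c]|D E D' _ [n d c] _ [n' d' c']].
- split.
  + apply/eqP; rewrite -eqz_nat !size_double_points; apply/eqP.
    by apply: state_sum_move mv; [exact: count_compatible | left].
  + by apply: state_sum_move mv; [exact: double_compatible | left].
  (* without double points no rigid vertex twist is possible *)
  + by move=> ns; apply: state_sum_move mv; [exact: classical_compatible | right].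
- by [].
- by split=> // /nsE ns; apply/esym/c/nsE; rewrite n.
- split; rewrite ?n ?d // => ns; rewrite c // c' //.
  by apply/nsE; rewrite -n; apply/nsE.
Qed.

Lemma extension_invariant : singular_knot_invariant (extension wriggle_polynomial).
Proof.
move=> D D' /same_knot_state_sums[n d c].
have [n0|n_gt0|n1] := ltngtP (size (double_points D)) 1.
- have ns : nonsingular D by apply: size0nil; lia.
  have ns' : nonsingular D' by apply: size0nil; lia.
  by rewrite !extension_nonsingular ?c.
- by rewrite !extension_many_double -?n.
- by rewrite !extension_one_double -?n.
Qed.

Lemma wriggle_polynomial_invariant : virtual_knot_invariant wriggle_polynomial.
Proof.
move=> D D' ns ns' /extension_invariant.
by rewrite /extension ns ns'.
Qed.

(** * The order is not zero *)

Definition trefoil_code : seq passage :=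
  [:: (1, true); (2, false); (3, true); (1, false); (2, true); (3, false)]%N.

Lemma trefoil_plane : plane_code trefoil_code.
Proof. by vm_compute. Qed.

(** Following the curve from the double point 1 to its second passage, one meets
the classical crossing 2 at (2, false) and the virtual crossing 3, so the index
of the double point is -1. *)
Definition singular_virtual_trefoil : diagram :=
  @Diagram trefoil_code true
    (fun x => match x with 1%N => DoublePoint | 2%N => Classical true | _ => Virtual end)
    trefoil_plane.

Lemma inverse_sum_neq2 (F : fieldType) (t : F) :
  t != 0 -> t != 1 -> t^-1 + t - 2 != 0.
Proof.
move=> t0 t1; have -> : t^-1 + t - 2 = (t - 1) ^+ 2 / t by field.
by rewrite mulf_neq0 ?invr_eq0 // expf_neq0 // subr_eq0.
Qed.

Lemma extension_trefoil :
  extension wriggle_polynomial singular_virtual_trefoil != 0.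
Proof.
have dpT : double_points singular_virtual_trefoil = [:: 1%N] by [].
rewrite /extension dpT resolve_one //.
have -> : chord_index (mark singular_virtual_trefoil)
    (code singular_virtual_trefoil) (1%N, true) = -1.
  by rewrite /chord_index !height_cons.
rewrite opprK expr1z -invr_expz expr1z; apply: inverse_sum_neq2.
  by rewrite /tvar tofrac_eq0 polyX_eq0.
rewrite /tvar -tofrac1 tofrac_eq; apply/eqP => /(congr1 (size \o polyseq)) /=.
by rewrite size_polyX size_poly1.
Qed.

Theorem mainTheorem2 :
  vassiliev_le 1 wriggle_polynomial /\ ~ vassiliev_le 0 wriggle_polynomial.
Proof.
split.
  split; [exact: wriggle_polynomial_invariant | exact: extension_invariant |].
  exact: extension_many_double.
case=> _ _ /(_ singular_virtual_trefoil isT); exact/eqP/extension_trefoil.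
Qed.
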